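(* For every integer $n\ge 1$, $$h(n)\ \ge\ \left\lceil\frac{\lambda(n)+1}{2}\right\rceil \qquad\text{and}\qquad \lambda(n)\ \ge\ h(n)-2,$$ where $\lambda(n)$ is the maximum possible length of an $x$-monotone path in an arrangement of $n$ lines, and $h(n)$ is the maximum cardinality of a set of points $\{p_1,\ldots,p_{h}\}$ in the plane, indexed so that the $x$-coordinate of $p_i$ is smaller than the $x$-coordinate of $p_j$ whenever $i<j$, such that there exists a set of $n$ non-vertical lines that strongly separates $p_i$ and $p_{i+1}$ for every $1\le i<h$.
   Context: Two non-vertical lines $\ell_1,\ell_2$ strongly separate two points $x,y$ if $x$ lies strictly above $\ell_1$ and strictly below $\ell_2$, and $y$ lies strictly above $\ell_2$ and strictly below $\ell_1$. A set $L$ of lines strongly separates the pair $x,y$ if $L$ contains two lines $\ell_1,\ell_2$ that strongly separate $x,y$. An $x$-monotone path in an arrangement of lines is an $x$-monotone polygonal path (each vertical line meets it in at most one point) contained in the union of the lines; its first and last edges may be unbounded rays. The length of such a path is the number of different line segments (including rays) that constitute the path, where consecutive segments on the path are assumed to belong to different lines of the arrangement; that is, if the path passes through a vertex of the arrangement without making a turn, this does not count as a new edge. *)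

(* Defs.v *)
From HB Require Import structures.
From mathcomp Require Import all_boot all_order all_algebra.
From mathcomp Require Import all_classical all_reals.
From mathcomp Require Import zify ring lra.

Set Implicit Arguments.
Unset Strict Implicit.
Unset Printing Implicit Defensive.

Import Order.TTheory GRing.Theory Num.Theory.
Local Open Scope classical_set_scope.
Local Open Scope ring_scope.

Notation plane R := (R * R)%type (only parsing).

Section Lines.
Variable R : realType.
Implicit Types (l : set (plane R)) (p q : plane R) (L P : set (plane R)).

Definition is_line l : Prop :=
  exists a b c : R, (a != 0) || (b != 0) /\
    l = [set p | a * p.1 + b * p.2 = c].

Definition nonvertical_line l : Prop :=
  exists m c : R, l = [set p | p.2 = m * p.1 + c].

Definition strictly_above p l : Prop := exists2 y, l (p.1, y) & y < p.2.

Definition strictly_below p l : Prop := exists2 y, l (p.1, y) & p.2 < y.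

Definition lines_strongly_separate l1 l2 p q : Prop :=
  [/\ strictly_above p l1, strictly_below p l2,
      strictly_above q l2 & strictly_below q l1].

Definition strongly_separates (L : set (set (plane R))) p q : Prop :=
  exists l1 l2, [/\ L l1, L l2 & lines_strongly_separate l1 l2 p q].

Definition x_monotone P : Prop :=
  forall p q, P p -> P q -> p.1 = q.1 -> p = q.

Definition edge l (a b : \bar R) : set (plane R) :=
  [set p | l p /\ (a <= p.1%:E <= b)%E].

(* The i-th edge (i < k) lies on l i, over the abscissae from t i to t i.+1.
   Since t is strictly increasing, only t 0 can be -oo and only t k can be +oo:
   the inner breakpoints are real and the first and last edges may be rays. *)
Definition path_of_length (L : set (set (plane R))) (k : nat) P : Prop :=
  exists (l : nat -> set (plane R)) (t : nat -> \bar R),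
    [/\ forall i, (i < k)%N -> L (l i) /\ nonvertical_line (l i),
        forall i, (i < k)%N -> (t i < t i.+1)%E,
        forall i, (i.+1 < k)%N -> l i <> l i.+1,
        forall i, (i.+1 < k)%N ->
          exists2 p, l i p /\ l i.+1 p & p.1%:E = t i.+1
      & P = \bigcup_(i in `I_k) edge (l i) (t i) (t i.+1)].

(* Vertical lines are allowed in the arrangement. *)
Definition has_x_monotone_path (n k : nat) : Prop :=
  exists (L : set (set (plane R))) P,
    [/\ forall l, L l -> is_line l, (L #= `I_n)%card,
        x_monotone P, P `<=` \bigcup_(l in L) l & path_of_length L k P].

Definition has_separated_points (n k : nat) : Prop :=
  exists (p : nat -> plane R) (L : set (set (plane R))),
    [/\ forall i j, (i < j < k)%N -> (p i).1 < (p j).1,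
        forall l, L l -> nonvertical_line l, (L #= `I_n)%card
      & forall i, (i.+1 < k)%N -> strongly_separates L (p i) (p i.+1)].

Lemma pairs_of_lines_bound (L : set (set (plane R))) n k
    (f g : nat -> set (plane R)) :
    (L #= `I_n)%card ->
    (forall i, (i < k)%N -> L (f i) /\ L (g i)) ->
    (forall i j, (i < j < k)%N -> f i = f j -> g i = g j -> False) ->
  (k <= n * n)%N.
Proof.
move=> /card_set_bijP[r [rfun rinj _]] fgL fginj.
have rlt l : L l -> (r l < n)%N by move=> Ll; apply: rfun.
have lt1 (i : 'I_k) : (r (f i) < n)%N by apply: rlt; case: (fgL i).
have lt2 (i : 'I_k) : (r (g i) < n)%N by apply: rlt; case: (fgL i).
pose F (i : 'I_k) := (Ordinal (lt1 i), Ordinal (lt2 i)).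
have Finj : injective F.
  move=> i j [e1 e2].
  have [Lfi Lgi] := fgL i (ltn_ord i); have [Lfj Lgj] := fgL j (ltn_ord j).
  have ef : f i = f j by apply: rinj; rewrite ?inE.
  have eg : g i = g j by apply: rinj; rewrite ?inE.
  apply/val_inj; case: (ltngtP i j) => // ij; exfalso.
  - by apply: (fginj i j) => //; rewrite ij ltn_ord.
  - by apply: (fginj j i) => //; rewrite ij ltn_ord.
by have := leq_card F Finj; rewrite card_prod !card_ord.
Qed.

Lemma lines_do_not_cross_twice (m c m' c' x1 x2 x3 y1 y2 y3 : R) :
  m * x1 + c < y1 -> y1 < m' * x1 + c' ->
  m' * x2 + c' < y2 -> y2 < m * x2 + c ->
  m * x3 + c < y3 -> y3 < m' * x3 + c' ->
  x1 < x2 -> x2 <= x3 -> False.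
Proof.
move=> u1 u2 v1 v2 w1 w2 x12 x23.
have d12 : 0 < (m - m') * (x2 - x1) by lra.
have x21 : 0 < x2 - x1 by rewrite subr_gt0.
have mm' : 0 < m - m' by move: d12; rewrite pmulr_lgt0.
have : 0 <= (m - m') * (x3 - x2) by apply: mulr_ge0; [exact: ltW | rewrite subr_ge0].
by lra.
Qed.

Lemma n_nonvertical_lines n : exists L : set (set (plane R)),
  (forall l, L l -> nonvertical_line l) /\ (L #= `I_n)%card.
Proof.
exists [set [set p : plane R | p.2 = 0 * p.1 + i%:R] | i in `I_n]; split.
  by move=> _ [i _ <-]; exists 0, i%:R.
apply: inj_card_eq => i j _ _ /seteqP[/(_ (0, i%:R)) /= h _].
apply/eqP; rewrite -(eqr_nat R); apply/eqP.
by move: h; rewrite !mul0r !add0r; apply.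
Qed.

Lemma nonvertical_is_line l : nonvertical_line l -> is_line l.
Proof.
move=> [m [c ->]]; exists (- m), 1, c; split; first by rewrite oner_eq0 orbT.
by apply/seteqP; split=> p /= e; lra.
Qed.

Lemma has_x_monotone_path_ex n : exists k, `[< has_x_monotone_path n k >].
Proof.
exists 0%N; apply/asboolP.
have [L [Lnv Ln]] := n_nonvertical_lines n.
exists L, set0; split => //.
  by move=> l /Lnv /nonvertical_is_line.
exists (fun=> set0), (fun=> 0%E); split => //.
by rewrite II0 bigcup_set0.
Qed.

Lemma has_x_monotone_path_bound n k :
  `[< has_x_monotone_path n k >] -> (k <= (n * n).+1)%N.
Proof.
move=> /asboolP[L [P [_ Ln _ _ [l [t [lL t_lt l_neq l_join _]]]]]].
case: k lL t_lt l_neq l_join => // k lL t_lt l_neq l_join.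
rewrite ltnS.
apply: (@pairs_of_lines_bound L n k l (fun i => l i.+1) Ln) => [i ik|i j].
  by have [Li _] := lL i (ltnW ik); have [Li1 _] := lL i.+1 ik.
move=> /andP[ij jk] e1 e2.
have t_mono d : (i.+1 + d.+1 <= k.+1)%N -> (t i.+1 < t (i.+1 + d.+1)%N)%E.
  elim: d => [|d IH] hd; first by rewrite addn1; apply: t_lt; lia.
  apply: (lt_trans (IH _)); first lia.
  by rewrite [in ltRHS]addnS; apply: t_lt; lia.
have [] : (t i.+1 < t j.+1)%E /\ t i.+1 = t j.+1; last by move=> /[swap] ->; rewrite ltxx.
split.
  have -> : j.+1 = (i.+1 + (j - i.+1).+1)%N by lia.
  by apply: t_mono; lia.
have ik : (i.+1 < k.+1)%N by lia.
have [p [p1 p2] <-] := l_join i ik.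
have [q [q1 q2] <-] := l_join j jk.
have := l_neq i ik.
move: q1 q2 p1 p2; rewrite -e1 -e2.
case: (lL i (ltnW ik)) => _ [m [c ->]].
case: (lL i.+1 ik) => _ [m' [c' ->]] /= q1 q2 p1 p2 ne.
congr (_%:E); apply/eqP; apply: contra_notT ne => pq.
have em : (m - m') * (p.1 - q.1) = 0 by rewrite mulrBr !mulrBl; lra.
move/eqP: em; rewrite mulf_eq0 !subr_eq0 (negbTE pq) orbF => /eqP em.
subst m'; suff -> : c = c' by [].
by apply: (addrI (m * p.1)); rewrite -p1 -p2.
Qed.

Lemma has_separated_points_ex n : exists k, `[< has_separated_points n k >].
Proof.
exists 0%N; apply/asboolP.
have [L [Lnv Ln]] := n_nonvertical_lines n.
by exists (fun=> (0, 0)), L; split => // i j; rewrite ltn0 andbF.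
Qed.

Lemma has_separated_points_bound n k :
  `[< has_separated_points n k >] -> (k <= (n * n).+1)%N.
Proof.
move=> /asboolP[p [L [p_lt Lnv Ln p_sep]]].
case: k p_lt p_sep => // k p_lt p_sep; rewrite ltnS.
have sep i : exists ll : set (plane R) * set (plane R), (i < k)%N ->
    [/\ L ll.1, L ll.2 & lines_strongly_separate ll.1 ll.2 (p i) (p i.+1)].
  case: (ltnP i k) => [ik|_]; last by exists (set0, set0).
  by have [l1 [l2 h]] := p_sep i ik; exists (l1, l2).
have [ll llP] := choice sep.
apply: (@pairs_of_lines_bound L n k (fun i => (ll i).1) (fun i => (ll i).2) Ln).
  by move=> i /llP[].
move=> i j /andP[ij jk] e1 e2.
have [L1 L2 [a1 b2 c2 d1]] := llP i (ltn_trans ij jk).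
have [_ _ [a1' b2' _ _]] := llP j jk.
move: a1 b2 c2 d1 a1' b2'; rewrite -e1 -e2.
have [m [c ->]] := Lnv _ L1; have [m' [c' ->]] := Lnv _ L2.
move=> [_ /= -> u1] [_ /= -> u2] [_ /= -> v1] [_ /= -> v2] [_ /= -> w1] [_ /= -> w2].
have x1 : (p i).1 < (p i.+1).1 by apply: p_lt; lia.
have x2 : (p i.+1).1 <= (p j).1.
  have [->//|ne] := eqVneq i.+1 j.
  by apply/ltW/p_lt; lia.
move: u1 u2 v1 v2 w1 w2 x1 x2.
exact: lines_do_not_cross_twice.
Qed.

Definition lambda (n : nat) : nat :=
  ex_maxn (has_x_monotone_path_ex n) (@has_x_monotone_path_bound n).

Definition hsep (n : nat) : nat :=
  ex_maxn (has_separated_points_ex n) (@has_separated_points_bound n).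

Lemma lambdaP n : has_x_monotone_path n (lambda n) /\
  forall k, has_x_monotone_path n k -> (k <= lambda n)%N.
Proof.
rewrite /lambda; case: ex_maxnP => m /asboolP mP mmax; split => // k kP.
by apply: mmax; apply/asboolP.
Qed.

Lemma hsepP n : has_separated_points n (hsep n) /\
  forall k, has_separated_points n k -> (k <= hsep n)%N.
Proof.
rewrite /hsep; case: ex_maxnP => m /asboolP mP mmax; split => // k kP.
by apply: mmax; apply/asboolP.
Qed.

End Lines.

(* Main.v *)
Require Import Defs.
From mathcomp Require Import all_boot all_order all_algebra.
From mathcomp Require Import all_classical all_reals.
From mathcomp Require Import zify ring lra.
Import Order.TTheory GRing.Theory Num.Theory.
Local Open Scope ring_scope.

(* First inequality: of the turns v_1, v_2, ... of a longest path keep those of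
   odd index.  At v_(2j+1) the two lines of the path cross, and they strongly
   separate any point of their left wedge from any point of their right wedge.
   Near v_(2j) there is a point that lies both in the right wedge of v_(2j-1)
   and in the left wedge of v_(2j+1).

   Second inequality: let w_i be the crossing of the two lines separating p_i
   and p_(i+1).  By induction some path reaches w_i after at least i turns: it
   can leave w_i on either of the two lines a, b through it, p_(i+1) is in the
   right wedge of w_i and in the left wedge of w_(i+1), and this forces one of
   the lines c, d through w_(i+1) to meet a or b in time for one more turn. *)
Section PathsAndPoints.
Set Implicit Arguments.
Unset Strict Implicit.
Local Open Scope classical_set_scope.
Variable R : realType.
Implicit Types (a b c d e f g v w : R * R) (x y z s : R).
Implicit Types (L : set (set (plane R))).

(** * Non-vertical lines as affine functions *)

(* A non-vertical line is encoded by the pair (slope, intercept). *)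
Definition ev v x : R := v.1 * x + v.2.
Definition graph v : set (plane R) := [set p | p.2 = ev v p.1].

Lemma graph_inj v w : graph v = graph w -> v = w.
Proof.
move=> /seteqP[vw _].
have e0 := vw (0, ev v 0) erefl; have e1 := vw (1, ev v 1) erefl.
move: v w e0 e1 {vw} => [m1 c1] [m2 c2]; rewrite /graph /ev /= => e0 e1.
by congr pair; lra.
Qed.

Lemma nonvertical_graph v : nonvertical_line (graph v).
Proof. by exists v.1, v.2. Qed.

Lemma nonvertical_lineP l : nonvertical_line l -> exists v, l = graph v.
Proof. by move=> [m [c ->]]; exists (m, c). Qed.

Lemma strictly_aboveE p v : strictly_above p (graph v) <-> ev v p.1 < p.2.
Proof. by split=> [[y + lt]|lt]; [rewrite /graph /= => <- | exists (ev v p.1)]. Qed.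

Lemma strictly_belowE p v : strictly_below p (graph v) <-> p.2 < ev v p.1.
Proof. by split=> [[y + lt]|lt]; [rewrite /graph /= => <- | exists (ev v p.1)]. Qed.

Lemma slope_neq v w x : v <> w -> ev v x = ev w x -> v.1 - w.1 != 0.
Proof.
move: v w => [m1 c1] [m2 c2]; rewrite /ev /= => ne e.
rewrite subr_eq0; apply: contra_notN ne => /eqP ?; subst m2.
by congr pair; lra.
Qed.

Lemma ev_eq2 v w x y : x != y -> ev v x = ev w x -> ev v y = ev w y -> v = w.
Proof.
move=> xy ex ey; apply: contrapT => /slope_neq/(_ ex) ne.
have : (v.1 - w.1) * (x - y) = 0 by move: ex ey; rewrite /ev; lra.
by move/eqP; rewrite mulf_eq0 (negbTE ne) subr_eq0 (negbTE xy).
Qed.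

(** The difference of two affine functions keeps its sign on each side of its zero. The positive
    product says that [y] and [z] are on the same side of [x], so that left and right are covered at
    once. *)
Lemma ev_lt_ray v w x y z : ev v x = ev w x -> ev v y < ev w y ->
  0 < (y - x) * (z - x) -> ev v z < ev w z.
Proof.
rewrite /ev => ex ey s.
have u : 0 < (w.1 - v.1) * (y - x) by lra.
suff : 0 < (w.1 - v.1) * (z - x) by lra.
have y2 : 0 < (y - x) ^+ 2.
  rewrite exprn_even_gt0 //=.
  by apply: contraTneq s => ->; rewrite mul0r ltxx.
rewrite -(pmulr_rgt0 _ y2).
have -> : (y - x) ^+ 2 * ((w.1 - v.1) * (z - x)) =
  (w.1 - v.1) * (y - x) * ((y - x) * (z - x)) by ring.
exact: mulr_gt0.
Qed.

Lemma lines_cross f g x y : x < y -> ev f x < ev g x -> ev g y < ev f y ->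
  exists2 s, x < s < y & ev f s = ev g s.
Proof.
rewrite /ev => xy hx hy.
have k : 0 < f.1 - g.1.
  have u : 0 < (f.1 - g.1) * (y - x) by lra.
  by move: u; rewrite pmulr_lgt0; lra.
exists ((g.2 - f.2) / (f.1 - g.1)).
  by rewrite ltr_pdivlMr // ltr_pdivrMr //; apply/andP; split; lra.
by field; rewrite gt_eqF.
Qed.

(** * Paths extended turn by turn *)

(* There is a path in [L] that comes from [-oo] and is on the line [v] at
   abscissa [s], after exactly [k] turns, all of them strictly before [s]. *)
Definition arrives L k v s : Prop :=
  exists (l : nat -> R * R) (t : nat -> R),
    [/\ forall i, (i <= k)%N -> L (graph (l i)),
        forall i, (i.+1 < k)%N -> t i < t i.+1,
        forall i, (i < k)%N ->
          [/\ t i < s, l i <> l i.+1 & ev (l i) (t i) = ev (l i.+1) (t i)]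
      & l k = v].

Lemma arrives0 L v s : L (graph v) -> arrives L 0 v s.
Proof. by move=> Lv; exists (fun=> v), (fun=> 0); split. Qed.

Lemma arrives_le L k v s s' : s <= s' -> arrives L k v s -> arrives L k v s'.
Proof.
move=> ss' [l [t [h1 h2 h3 h4]]]; exists l, t; split=> // i /h3[ts ? ?].
by split=> //; apply: lt_le_trans ss'.
Qed.

Lemma arrives_turn L k v w s s' : arrives L k v s -> L (graph w) -> v <> w ->
  ev v s = ev w s -> s < s' -> arrives L k.+1 w s'.
Proof.
move=> [l [t [h1 h2 h3 h4]]] Lw vw e ss'.
exists (fun i => if (i <= k)%N then l i else w),
       (fun i => if (i < k)%N then t i else s); split.
- by move=> i _; case: ifP => // /h1.
- move=> i; rewrite ltnS => ik; rewrite ik; case: ifP => [/h2 //|_].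
  by have [] := h3 i ik.
- move=> i; rewrite ltnS => ik; rewrite ik; case: ifP => [ik'|/negbT nik].
    by have [h ? ?] := h3 i ik'; split=> //; apply: lt_trans ss'.
  have -> : i = k by lia.
  by rewrite h4.
- by rewrite ltnn.
Qed.

(** Serves to leave a crossing on either of its two lines: one turn is made at [s] if the lines
    differ and none otherwise, so no turn is lost. *)
Lemma arrives_through L k v w s : arrives L k v s -> L (graph w) ->
  ev v s = ev w s ->
  exists2 j, (k <= j)%N & forall s', s < s' -> arrives L j w s'.
Proof.
move=> vk Lw e; have [<-|/eqP vw] := eqVneq v w.
  by exists k => // s' /ltW ss'; apply: arrives_le vk.
by exists k.+1 => // s'; apply: arrives_turn vk Lw vw e.
Qed.

(** The order of [f] and [g] flips between [x'] and [y'], so they meet strictly after [x] and before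
    [y], where the path can turn onto [g]. *)
Lemma arrives_cross L k f g x x' y' y : (forall s, x < s -> arrives L k f s) ->
    L (graph g) -> x <= x' -> x' < y' -> y' <= y ->
    (ev f x' < ev g x' /\ ev g y' < ev f y') \/
    (ev g x' < ev f x' /\ ev f y' < ev g y') ->
  arrives L k.+1 g y.
Proof.
move=> fk Lg xx' xy' y'y h.
have fg : f <> g by move=> E; move: h; rewrite E !ltxx; case => -[].
have [s /andP[xs sy] e] : exists2 s, x' < s < y' & ev f s = ev g s.
  case: h => -[h1 h2]; first exact: lines_cross.
  by have [s ? ?] := lines_cross xy' h1 h2; exists s.
apply: (arrives_turn (s := s) (fk s _)) => //; first exact: le_lt_trans xs.
exact: lt_le_trans y'y.
Qed.

(* If neither [c] meets [b] nor [d] meets [a] strictly between the two crossings,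
   then each crossing lies in the closed wedge of the other, so [c] meets [a] and
   [d] meets [b]; these meetings may happen at the crossings themselves. *)
Lemma arrives_next_crossing L k a b c d v x y z q :
    L (graph a) -> L (graph b) -> L (graph c) -> L (graph d) ->
    x < z -> z < y -> ev a x = ev b x -> ev c y = ev d y ->
    ev a z < q -> ev c z < q -> q < ev b z -> q < ev d z ->
    arrives L k v x -> L (graph v) -> ev v x = ev a x ->
  exists j w, [/\ (k < j)%N, arrives L j w y, L (graph w) & ev w y = ev c y].
Proof.
move=> La Lb Lc Ld xz zy abx cdy az cz bz dz vk Lv vax.
(* The order of [a] and [b] at [z] persists to the right up to [y], and that of [c] and [d] persists
   to the left down to [x]. *)
have ab_y : ev a y < ev b y.
  by apply: (ev_lt_ray (x := x) (y := z)) => //;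
    [exact: lt_trans bz | apply: mulr_gt0; lra].
have cd_x : ev c x < ev d x.
  by apply: (ev_lt_ray (x := y) (y := z)) => //;
    [exact: lt_trans dz | rewrite nmulr_rgt0; lra].
have [ja ka Aa] := arrives_through vk La vax.
have [jb kb Ab] := arrives_through vk Lb (etrans vax abx).
have cb_z : ev c z < ev b z by exact: lt_trans bz.
have ad_z : ev a z < ev d z by exact: lt_trans dz.
have xy := lt_trans xz zy.
have from_a g x' y' (Lg : L (graph g)) : ev g y = ev c y ->
    x <= x' -> x' < y' -> y' <= y ->
    (ev a x' < ev g x' /\ ev g y' < ev a y') \/
    (ev g x' < ev a x' /\ ev a y' < ev g y') ->
    exists j w, [/\ (k < j)%N, arrives L j w y, L (graph w) & ev w y = ev c y].
  by move=> gy ? ? ? h; exists ja.+1, g; split => //; apply: arrives_cross Aa _ _ _ _ h.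
have from_b g x' y' (Lg : L (graph g)) : ev g y = ev c y ->
    x <= x' -> x' < y' -> y' <= y ->
    (ev b x' < ev g x' /\ ev g y' < ev b y') \/
    (ev g x' < ev b x' /\ ev b y' < ev g y') ->
    exists j w, [/\ (k < j)%N, arrives L j w y, L (graph w) & ev w y = ev c y].
  by move=> gy ? ? ? h; exists jb.+1, g; split => //; apply: arrives_cross Ab _ _ _ _ h.
(* Once these four cases are settled, [c <= a = b <= d] holds at [x] and [a <= c = d <= b] holds at
   [y]. *)
have [bc_x|cb_x] := ltP (ev b x) (ev c x).
  by apply: (from_b c x z) => //; [exact: ltW | left].
have [bc_y|cb_y] := ltP (ev b y) (ev c y).
  by apply: (from_b c z y) => //; [exact: ltW | right].
have [da_x|ad_x] := ltP (ev d x) (ev a x).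
  by apply: (from_a d x z) => //; [exact: ltW | right].
have [da_y|ad_y] := ltP (ev d y) (ev a y).
  by apply: (from_a d z y) => //; [exact: ltW | left].
(* If [g] passes through both crossings, the extra turn can be taken at [x] itself, provided that
   the path arrives there on another line. *)
have turn_x g : L (graph g) -> ev v x = ev g x -> v <> g -> ev g y = ev c y ->
    exists j w, [/\ (k < j)%N, arrives L j w y, L (graph w) & ev w y = ev c y].
  by move=> Lg vg ne gy; exists k.+1, g; split => //; apply: arrives_turn vk Lg ne vg xy.
have neq_z f g : ev f z < ev g z -> f <> g by move=> /[swap] ->; rewrite ltxx.
rewrite -abx in cb_x; move: cb_x; rewrite le_eqVlt => /orP[/eqP ca_x|ca_x].
  rewrite cdy in cb_y; move: cb_y; rewrite le_eqVlt => /orP[/eqP db_y|db_y]; last first.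
    apply: (from_b d x y) => //; left; split => //; by rewrite -abx -ca_x.
  have [vb|/eqP vb] := eqVneq v b.
    by apply: (turn_x c) => //; [rewrite vax ca_x | rewrite vb => /esym; apply: neq_z].
  by apply: (turn_x b) => //; [rewrite vax | rewrite -db_y cdy].
rewrite -cdy in ad_y; move: ad_y; rewrite le_eqVlt => /orP[/eqP ac_y|ac_y]; last first.
  by apply: (from_a c x y) => //; right.
move: ad_x; rewrite le_eqVlt => /orP[/eqP ad_x|ad_x].
  have [va|/eqP va] := eqVneq v a.
    by apply: (turn_x d) => //; [rewrite vax ad_x | rewrite va; apply: neq_z].
  by apply: (turn_x a).
apply: (from_b d x y) => //; left; split; first by rewrite -abx.
by rewrite -cdy -ac_y.
Qed.

(** * From sequences of turns to x-monotone paths *)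

Lemma path_extend L k v s : arrives L k v s -> exists P, path_of_length L k.+1 P.
Proof.
move=> [l [t [h1 h2 h3 h4]]].
(* The turns are shifted by one index to make room for [-oo], and [+oo] follows the last turn: the
   end edges are rays, and [k] turns give [k.+1] edges. *)
pose T i := if i is j.+1 then (if (j < k)%N then (t j)%:E else +oo%E) else -oo%E.
exists (\bigcup_(i in `I_k.+1) edge (graph (l i)) (T i) (T i.+1)).
exists (fun i => graph (l i)), T; split=> //.
- by move=> i ik; split; [exact: h1 | exact: nonvertical_graph].
- case=> [|i] /= ik; first by case: ifP => _; rewrite ?ltNyr.
  rewrite ltnS in ik; rewrite ik; case: ifP => [jk|_]; last exact: ltry.
  by rewrite lte_fin; apply: h2.
- by move=> i ik /graph_inj; case: (h3 i ik).
- move=> i ik; have [_ _ e] := h3 i ik.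
  rewrite /T /= -ltnS ik; exists (t i, ev (l i) (t i)) => //.
Qed.

Lemma breakpoints_lt k (t : nat -> \bar R) :
    (forall i, (i < k)%N -> (t i < t i.+1)%E) ->
  forall i j, (i < j <= k)%N -> (t i < t j)%E.
Proof.
move=> tlt i; elim=> [|j IH] /andP[ij jk]; first by [].
have [->|ne] := eqVneq i j; first exact: tlt.
by apply: lt_trans (tlt j jk); apply: IH; lia.
Qed.

(** Two edges over a common abscissa are equal or consecutive, because an edge between them would
    have positive width. If consecutive, both points are the shared breakpoint [r]. *)
Lemma path_x_monotone L k P : path_of_length L k P -> x_monotone P.
Proof.
move=> [l [t [lL tlt _ tl ->]]] p q [i /= ik [lp tp]] [j /= jk [lq tq]].
wlog ij : p q i j ik jk lp lq tp tq / (i <= j)%N.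
  move=> h pq; case/orP: (leq_total i j) => ij; first exact: (h p q i j).
  by apply/esym; apply: (h q p j i).
move=> pq.
have graph_eq u p' q' : p'.1 = q'.1 -> graph u p' -> graph u q' -> p' = q'.
  by case: p' q' => [p1 p2] [q1 q2]; rewrite /graph /= => -> -> ->.
have [_ /nonvertical_lineP[u lu]] := lL i ik.
have [ji|ne] := eqVneq i j.
  by apply: (graph_eq u) => //; rewrite -lu // ji.
have ti : (t i.+1 <= t j)%E.
  have [->//|ne'] := eqVneq i.+1 j.
  by apply/ltW/(breakpoints_lt tlt); lia.
have iSk : (i.+1 < k)%N by lia.
have [r [r1 r2] rt] := tl i iSk.
move: tp tq => /andP[_ tp] /andP[tq _].
have ji : j = i.+1.
  apply: contrapT => ne'.
  have tij : (t i.+1 < t j)%E by apply: (breakpoints_lt tlt); lia.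
  by have := lt_le_trans tij tq; rewrite -pq => /lt_le_trans/(_ tp); rewrite ltxx.
subst j.
have pr : p.1 = r.1.
  by apply/eqP; rewrite eq_le -!lee_fin rt tp pq tq.
have [_ /nonvertical_lineP[w lw]] := lL i.+1 iSk.
transitivity r; first by apply: (graph_eq u) => //; rewrite -lu.
by apply: (graph_eq w); rewrite -?pq -?lw.
Qed.

Lemma has_path_of_arrives L n k v s : (forall l, L l -> nonvertical_line l) ->
  (L #= `I_n)%card -> arrives L k v s -> has_x_monotone_path R n k.+1.
Proof.
move=> Lnv Ln /path_extend[P Pk]; exists L, P; split=> //.
- by move=> l /Lnv /nonvertical_is_line.
- exact: path_x_monotone Pk.
- case: Pk => l [t [lL _ _ _ ->]] p [i ik [lp _]].
  by exists (l i) => //; case: (lL i ik).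
Qed.

(** * From separated points to a path: the second inequality *)

(** The order of [v] and [w] matters: [v] is the lower line at [p] and the upper one at [q]. *)
Definition crossing L (p q : plane R) v w x : Prop :=
  [/\ L (graph v), L (graph w), p.1 < x < q.1, ev v x = ev w x
    & ev v p.1 < p.2 < ev w p.1 /\ ev w q.1 < q.2 < ev v q.1].

Lemma crossing_of_separated L p q : (forall l, L l -> nonvertical_line l) ->
  p.1 < q.1 -> strongly_separates L p q -> exists v w x, crossing L p q v w x.
Proof.
move=> Lnv pq [l1 [l2 [L1 L2 []]]].
have [v ev1] := nonvertical_lineP (Lnv _ L1); subst l1.
have [w ew1] := nonvertical_lineP (Lnv _ L2); subst l2.
move=> /strictly_aboveE v1 /strictly_belowE w1 /strictly_aboveE w2 /strictly_belowE v2.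
have [x px vw] := lines_cross pq (lt_trans v1 w1) (lt_trans w2 v2).
by exists v, w, x; split; rewrite ?v1 ?w1 ?w2.
Qed.

Lemma separated_arrives L k (p : nat -> plane R) :
    (forall l, L l -> nonvertical_line l) ->
    (forall i j, (i < j < k)%N -> (p i).1 < (p j).1) ->
    (forall i, (i.+1 < k)%N -> strongly_separates L (p i) (p i.+1)) ->
  forall i, (i.+1 < k)%N -> exists v w x j u,
    [/\ crossing L (p i) (p i.+1) v w x, (i <= j)%N, arrives L j u x,
        L (graph u) & ev u x = ev v x].
Proof.
move=> Lnv plt psep.
have cr i : (i.+1 < k)%N -> exists v w x, crossing L (p i) (p i.+1) v w x.
  move=> ik; apply: crossing_of_separated => //; last exact: psep.
  by apply: plt; rewrite ltnSn.
elim=> [|i IH] ik.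
  have [v [w [x c]]] := cr 0%N ik; exists v, w, x, 0%N, v; split=> //.
    by apply: arrives0; case: c.
  by case: c.
(* Past the crossing the lines have swapped: the first one is now above [p i.+1] and takes the role
   of [b], the second one that of [a]. *)
have [b [a [x [k' [u [[Lb La /andP[_ xp] ba [_ /andP[ap pb]]] kk uk Lu ub]]]]]] :=
  IH (ltnW ik).
have [c [d [y cd]]] := cr i.+1 ik.
have [Lc Ld /andP[py _] cdy [/andP[cp pd] _]] := cd.
have [j [w [kj wj Lw wy]]] :=
  arrives_next_crossing La Lb Lc Ld xp py (esym ba) cdy ap cp pb pd uk Lu (etrans ub ba).
by exists c, d, y, j, w; split=> //; apply: leq_ltn_trans kj.
Qed.

(** Among [h >= 2] points the last crossing has index [h - 2]; reaching it takes at least [h - 2]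
    turns, hence a path of at least [h - 1] edges. *)
Lemma hsep_le_lambdaS n : (hsep R n <= (lambda R n).+1)%N.
Proof.
have [[p [L [plt Lnv Ln psep]]] _] := hsepP R n.
have [_ lmax] := lambdaP R n.
case: (hsep R n) plt psep => [//|[//|k]] plt psep.
have [v [w [x [j [u [_ kj uj _ _]]]]]] := separated_arrives Lnv plt psep (ltnSn k.+1).
by have := lmax _ (has_path_of_arrives Lnv Ln uj); lia.
Qed.

(** * From a path to separated points: the first inequality *)

(** Vertical lines of an arrangement carry no edge of a path but are not allowed for separation;
    fresh non-vertical lines replace them to keep the count [n]. *)
Lemma nonvertical_superset L n : (L #= `I_n)%card ->
  exists L', [/\ forall l, L' l -> nonvertical_line l, (L' #= `I_n)%card
    & forall l, L l -> nonvertical_line l -> L' l].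
Proof.
move=> Ln.
have extend (d : nat) : forall m (A : set (set (plane R))), (forall l, A l -> nonvertical_line l) ->
    (A #= `I_m)%card -> exists A', [/\ forall l, A' l -> @nonvertical_line R l,
      (A' #= `I_(m + d))%card & A `<=` A'].
  elim: d => [|d IH] m A Anv Am; first by exists A; rewrite addn0; split.
  have [M [Mnv Mm]] := n_nonvertical_lines R m.+1.
  (* Pigeonhole: [m.+1] lines do not fit into [A], which has [m]. *)
  have [l [Ml Al]] : exists l, M l /\ ~ A l.
    apply: contrapT => h.
    have MA : M `<=` A by move=> l Ml; apply: contrapT => Al; apply: h; exists l.
    have := subset_card_le MA.
    by rewrite (card_le_eql Mm) (card_le_eqr Am) card_le_II ltnn.
  have [||A' [nv c s]] := IH m.+1 (l |` A).
  - by move=> _ [->|/Anv//]; exact: Mnv.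
  - apply/eq_cardSP; exists l; first by left.
    suff -> : (l |` A) `\ l = A by [].
    apply/seteqP; split=> [x [[//|//]]|x Ax]; split; first by right.
    by move=> xl; apply: Al; rewrite -xl.
  exists A'; split=> //; first by rewrite addnS -addSn.
  by move=> x Ax; apply: s; right.
pose A := [set l | L l /\ nonvertical_line l].
have AL : A `<=` L by move=> l [].
have [m Am] : finite_set A by apply: sub_finite_set AL _; exists n.
have mn : (m <= n)%N.
  by have := subset_card_le AL; rewrite (card_le_eql Am) (card_le_eqr Ln) card_le_II.
have [|A' [nv c s]] := extend (n - m)%N m A _ Am; first by move=> l [].
exists A'; split=> //; first by rewrite subnKC in c.
by move=> l Ll nl; apply: s.
Qed.

(** For crossing lines, this is the union of the open left and right wedges. *)
Definition between v w (p : plane R) : Prop :=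
  ev v p.1 < p.2 < ev w p.1 \/ ev w p.1 < p.2 < ev v p.1.

Lemma between_mul v w p : (p.2 - ev v p.1) * (p.2 - ev w p.1) < 0 -> between v w p.
Proof.
move=> h; have [vp|pv] := ltP (ev v p.1) p.2.
  by left; move: h; rewrite pmulr_rlt0 ?subr_gt0 // subr_lt0 vp.
have {pv} pv : p.2 < ev v p.1.
  by rewrite lt_neqAle pv andbT; apply: contraTneq h => ->; rewrite subrr mul0r ltxx.
by right; move: h; rewrite nmulr_rlt0 ?subr_lt0 // subr_gt0 => ->.
Qed.

Lemma ev_lt_segment v w x y z : x < y -> y < z -> ev v x < ev w x ->
  ev v z < ev w z -> ev v y < ev w y.
Proof.
move=> xy yz hx hz.
have : 0 < (z - y) * (ev w x - ev v x) + (y - x) * (ev w z - ev v z).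
  by apply: addr_gt0; apply: mulr_gt0; rewrite subr_gt0.
have -> : (z - y) * (ev w x - ev v x) + (y - x) * (ev w z - ev v z) =
  (z - x) * (ev w y - ev v y) by rewrite /ev; ring.
by rewrite pmulr_rgt0 subr_gt0 // (lt_trans xy).
Qed.

(** If the two lines had the same order at [p] and at [q], convexity would keep it strict at [x];
    opposite orders are strong separation. *)
Lemma between_separate v w p q x : ev v x = ev w x ->
    p.1 < x -> x < q.1 -> between v w p -> between v w q ->
  lines_strongly_separate (graph v) (graph w) p q \/
  lines_strongly_separate (graph w) (graph v) p q.
Proof.
move=> vw px xq; case=> /andP[p1 p2] [] /andP[q1 q2].
- have := ev_lt_segment px xq (lt_trans p1 p2) (lt_trans q1 q2).
  by rewrite vw ltxx.
- by left; split; [apply/strictly_aboveE | apply/strictly_belowE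
    | apply/strictly_aboveE | apply/strictly_belowE].
- by right; split; [apply/strictly_aboveE | apply/strictly_belowE
    | apply/strictly_aboveE | apply/strictly_belowE].
- have := ev_lt_segment px xq (lt_trans p1 p2) (lt_trans q1 q2).
  by rewrite vw ltxx.
Qed.

Lemma between_midpoint v w x y : v <> w -> ev v x = ev w x -> x != y ->
  between v w (y, (ev v y + ev w y) / 2).
Proof.
move=> vw ex xy; rewrite /between /=.
have [lt|lt|/(ev_eq2 xy ex)//] := ltgtP (ev v y) (ev w y).
- by left; apply/andP; split; lra.
- by right; apply/andP; split; lra.
Qed.

Lemma exists_small (s : seq R) :
  exists2 e : R, 0 < e & forall C, C \in s -> e * C < 1.
Proof.
elim: s => [|C s [e e0 es]]; first by exists 1.
have C1 : 0 < 1 + `|C| by have := normr_ge0 C; lra.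
exists (Num.min e (1 + `|C|)^-1); first by rewrite lt_min e0 invr_gt0.
move=> D; have [D0|D0] := leP D 0.
  by move=> _; apply: le_lt_trans ltr01; rewrite mulr_ge0_le0 // le_min !ltW // invr_gt0.
rewrite inE => /orP[/eqP DC|/es]; last first.
  by apply: le_lt_trans; rewrite ler_pM2r // ge_min lexx.
apply: (@le_lt_trans _ _ ((1 + `|C|)^-1 * D)).
  by rewrite ler_pM2r // ge_min lexx orbT.
by rewrite mulrC ltr_pdivrMr // mul1r DC; have := ler_norm C; lra.
Qed.

(* Near the crossing of [b] and [c] all sign patterns of the heights over [b]
   and [c] occur; the one needed is dictated by [a] and [d], which miss the
   crossing. *)
Lemma between_both a b c d x y z : x < y -> y < z ->
    a <> b -> b <> c -> c <> d ->
    ev a x = ev b x -> ev b y = ev c y -> ev c z = ev d z ->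
  exists p, [/\ x < p.1, p.1 < z, between a b p & between c d p].
Proof.
move=> xy yz nab nbc ncd eab ebc ecd.
pose A := ev a y - ev b y; pose B := ev d y - ev c y.
have A0 : A != 0.
  by rewrite subr_eq0; apply/eqP => /(ev_eq2 (negbT (lt_eqF xy)) eab).
have B0 : B != 0.
  rewrite subr_eq0; apply/eqP => e; apply: ncd.
  by apply: (ev_eq2 (negbT (gt_eqF yz)) ecd).
have k0 := slope_neq nbc ebc.
(* With this [D], the point over [y + e * D] at height [e * A] above [b] is at height [e * B] above
   [c]. At [y], [a] is at height [A] above [b] and [d] at height [B] above [c], so a small [e] puts
   the point between both pairs. *)
pose D := (B - A) / (b.1 - c.1).
(* The first two bounds put the point between the lines; the last two keep its abscissa between [x]
   and [z]. *)
have [e e0 es] := exists_small [:: 1 + (b.1 - a.1) * D / A;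
  1 + (c.1 - d.1) * D / B; D / (z - y); - D / (y - x)].
have e1 := es _ (mem_head _ _).
have e2 : e * (1 + (c.1 - d.1) * D / B) < 1 by apply: es; rewrite !inE eqxx ?orbT.
have e3 : e * (D / (z - y)) < 1 by apply: es; rewrite !inE eqxx ?orbT.
have e4 : e * (- D / (y - x)) < 1 by apply: es; rewrite !inE eqxx ?orbT.
exists (y + e * D, ev b y + b.1 * (e * D) + e * A); split => /=.
- by move: e4; rewrite mulrA ltr_pdivrMr ?subr_gt0 //; lra.
- by move: e3; rewrite mulrA ltr_pdivrMr ?subr_gt0 //; lra.
- apply: between_mul => /=.
  have -> : (ev b y + b.1 * (e * D) + e * A - ev a (y + e * D)) *
      (ev b y + b.1 * (e * D) + e * A - ev b (y + e * D)) =
      (e * A ^+ 2) * (e * (1 + (b.1 - a.1) * D / A) - 1).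
    have -> : ev a (y + e * D) = A + ev b y + a.1 * (e * D) by rewrite /A /ev; ring.
    have -> : ev b (y + e * D) = ev b y + b.1 * (e * D) by rewrite /ev; ring.
    by field.
  by rewrite pmulr_rlt0 ?subr_lt0 // mulr_gt0 // exprn_even_gt0.
- apply: between_mul => /=.
  have -> : ev b y + b.1 * (e * D) + e * A = ev c y + c.1 * (e * D) + e * B.
    by rewrite ebc /D; field.
  have -> : (ev c y + c.1 * (e * D) + e * B - ev c (y + e * D)) *
      (ev c y + c.1 * (e * D) + e * B - ev d (y + e * D)) =
      (e * B ^+ 2) * (e * (1 + (c.1 - d.1) * D / B) - 1).
    have -> : ev d (y + e * D) = B + ev c y + d.1 * (e * D) by rewrite /B /ev; ring.
    have -> : ev c (y + e * D) = ev c y + c.1 * (e * D) by rewrite /ev; ring.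
    by field.
  by rewrite pmulr_rlt0 ?subr_lt0 // mulr_gt0 // exprn_even_gt0.
Qed.

Lemma separated_points_of_path n k : has_x_monotone_path R n k ->
  has_separated_points R n k./2.+1.
Proof.
move=> [L [P [_ Ln _ _ [l [t [lL tlt lne tl _]]]]]].
have [L' [Lnv' Ln' LL']] := nonvertical_superset Ln.
have /choice[v lv] : forall i, exists v, (i < k)%N -> l i = graph v.
  move=> i; case: (ltnP i k) => [ik|_]; last by exists 0.
  by have [_ /nonvertical_lineP[v]] := lL i ik; exists v.
have Lv i : (i < k)%N -> L' (graph (v i)).
  by move=> ik; rewrite -lv //; case: (lL i ik); apply: LL'.
have vne i : (i.+1 < k)%N -> v i <> v i.+1.
  by move=> ik e; apply: (lne i ik); rewrite !lv ?e // ltnW.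
(* [fine] sends infinite ends to [0], but [r] is only evaluated at inner breakpoints. *)
pose r i := fine (t i).
have tr i : (i.+1 < k)%N -> t i.+1 = (r i.+1)%:E.
  by move=> ik; have [p _ pt] := tl i ik; rewrite /r -pt.
have vr i : (i.+1 < k)%N -> ev (v i) (r i.+1) = ev (v i.+1) (r i.+1).
  move=> ik; have [p [p1 p2] pt] := tl i ik.
  move: p1 p2; rewrite /r -pt !lv //; last exact: ltnW.
  by rewrite /graph /= => <- <-.
have rlt i j : (i < j)%N -> (j.+1 < k)%N -> r i.+1 < r j.+1.
  move=> ij jk; rewrite -lte_fin -!tr //; last lia.
  by apply: (breakpoints_lt tlt); lia.
(* The kept turn number [j] joins edges [j.*2] and [j.*2.+1]. There are [k./2] such turns, hence
   [k./2.+1] points around them. *)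
pose right_of j (p : plane R) :=
  r j.*2.+1 < p.1 /\ between (v j.*2) (v j.*2.+1) p.
pose left_of j (p : plane R) :=
  p.1 < r j.*2.+1 /\ between (v j.*2) (v j.*2.+1) p.
have /choice[p pP] : forall j, exists p : plane R, (j <= k./2)%N ->
    ((0 < j)%N -> right_of j.-1 p) /\ ((j < k./2)%N -> left_of j p).
  move=> j; case: (leqP j k./2) => jk; last by exists 0.
  case: (ltnP j k./2) => jK; last first.
    (* The last point has one constraint only: take the midpoint of the two lines one unit after the
       last kept turn. The first point is chosen symmetrically below. *)
    case: j jk jK => [|j] jk jK; first by exists 0; split.
    exists (r j.*2.+1 + 1,
      (ev (v j.*2) (r j.*2.+1 + 1) + ev (v j.*2.+1) (r j.*2.+1 + 1)) / 2).
    split=> // _; split; first by rewrite /=; lra.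
    apply: (between_midpoint (x := r j.*2.+1)); last by rewrite lt_eqF //; lra.
    - by apply: vne; lia.
    - by apply: vr; lia.
  case: j jk jK => [|j] jk jK.
    exists (r 1%N - 1, (ev (v 0%N) (r 1%N - 1) + ev (v 1%N) (r 1%N - 1)) / 2).
    split=> // _; split; first by rewrite /= double0; lra.
    apply: (between_midpoint (x := r 1%N)); last by rewrite gt_eqF //; lra.
    - by apply: vne; lia.
    - by apply: vr; lia.
  have k3 : (j.*2.+3 < k)%N by lia.
  have [|||||||| p [p1 p2 p3 p4]] := @between_both (v j.*2) (v j.*2.+1) (v j.*2.+2)
    (v j.*2.+3) (r j.*2.+1) (r j.*2.+2) (r j.*2.+3).
  - by apply: rlt; lia.
  - by apply: rlt; lia.
  - by apply: vne; lia.
  - by apply: vne; lia.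
  - by apply: vne; lia.
  - by apply: vr; lia.
  - by apply: vr; lia.
  - by apply: vr; lia.
  by exists p => _; split=> _; split.
exists p, L'; split=> //.
- move=> i j /andP[ij jk].
  have iK : (i < k./2)%N by lia.
  have [_ /(_ iK)[pi _]] := pP i (ltnW iK).
  have [/(_ (leq_ltn_trans (leq0n i) ij))[pj _] _] := pP j jk.
  apply: lt_trans pi _; apply: le_lt_trans pj.
  have [->//|ne] := eqVneq i j.-1.
  by apply/ltW/rlt; lia.
- move=> i ik.
  have iK : (i < k./2)%N by lia.
  have [_ /(_ iK)[pi bi]] := pP i (ltnW iK).
  have [/(_ isT)[pj bj] _] := pP i.+1 iK.
  have vi : ev (v i.*2) (r i.*2.+1) = ev (v i.*2.+1) (r i.*2.+1) by apply: vr; lia.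
  have Lv1 : L' (graph (v i.*2)) by apply: Lv; lia.
  have Lv2 : L' (graph (v i.*2.+1)) by apply: Lv; lia.
  have [h|h] := between_separate vi pi pj bi bj.
    by exists (graph (v i.*2)), (graph (v i.*2.+1)).
  by exists (graph (v i.*2.+1)), (graph (v i.*2)).
Qed.

End PathsAndPoints.

Theorem proposition1 (R : realType) (n : nat) (n_ge1 : (1 <= n)%N) :
  (hsep R n)%:Z >= Num.ceil (((lambda R n)%:R + 1) / 2 : R) /\
  (lambda R n)%:Z >= (hsep R n)%:Z - 2.
Proof.
split; last by have := hsep_le_lambdaS R n; lia.
have [/separated_points_of_path lambdaK _] := lambdaP R n.
have [_ /(_ _ lambdaK) hK] := hsepP R n.
(* Halving loses at most one: [k <= 2 * k./2 + 1]. *)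
have {hK} : (lambda R n + 1 <= 2 * hsep R n)%N by lia.
rewrite ceil_le_int -(ler_nat R) natrD natrM => hK.
by rewrite ler_pdivrMr //; rewrite -pmulrn; lra.
Qed.
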